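(* Let $a\in\mathbb{R}$, $c_1>0$, $\gamma_1\in(0,1]$, and let $f\colon[0,1]^d\to\mathbb{R}$ be any $(c_1,\gamma_1)$-gradient-Hölder function with level set $\{f=a\}\ne\varnothing$. Let $d^\star\in[d-1,d]$ be a NLS dimension of $\{f=a\}$. Then there exist constants $\kappa_1,\kappa_2,\kappa(d^\star)\ge0$, independent of $\varepsilon$ (depending exponentially on $d$), such that for any accuracy $\varepsilon>0$ and all $n>m(\varepsilon)$, the output $S_n$ returned by the BAG algorithm (run with input $a,c_1,\gamma_1$ on $f$) after the $n$-th query is an $\varepsilon$-approximation of $\{f=a\}$, where \[ m(\varepsilon):=\begin{cases}\kappa_1+\kappa_2\,\Bigl(\log_2\bigl(1/\varepsilon^{1/(1+\gamma_1)}\bigr)\Bigr)^+ & \text{if } d^\star=0,\\[1ex] \kappa(d^\star)\,\dfrac{1}{\varepsilon^{d^\star/(1+\gamma_1)}} & \text{if } d^\star>0,\end{cases} \] and $x^+=\max\{x,0\}$.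
   Context: $d\ge1$ is an integer. $\{f=a\}:=\{x\in[0,1]^d: f(x)=a\}$ and $\{|f-a|\le r\}:=\{x\in[0,1]^d:|f(x)-a|\le r\}$. A set $S\subseteq[0,1]^d$ is an $\varepsilon$-approximation of $\{f=a\}$ if $\{f=a\}\subseteq S\subseteq\{|f-a|\le\varepsilon\}$. For $E\subseteq[0,1]^d$, a function $f\colon E\to\mathbb{R}$ is $(c_1,\gamma_1)$-gradient-Hölder if it is the restriction to $E$ of a continuously differentiable function defined on $\mathbb{R}^d$ (also denoted $f$) such that $\|\nabla f(x)-\nabla f(y)\|_\infty\le c_1\|x-y\|_\infty^{\gamma_1}$ for all $x,y\in E$. Packing number: for $r>0$ and $E\subseteq[0,1]^d$, $\mathcal{N}(E,r):=\sup\{k\in\{1,2,\dots\}:\exists\,x_1,\dots,x_k\in E,\ \min_{i\neq j}\|x_i-x_j\|_\infty>r\}$ if $E\ne\varnothing$, and $0$ otherwise. NLS dimension: $d^\star\ge0$ is a NLS dimension of $\{f=a\}$ if there exists $C^\star>0$ such that $\mathcal{N}(\{|f-a|\le r\},r)\le C^\star(1/r)^{d^\star}$ for all $r\in(0,1)$. Bisection: for a family $\mathcal{C}$ of hypercubes in $[0,1]^d$, $\mathrm{bisect}(\mathcal{C})$ is the family obtained by subdividing each $[a_1,b_1]\times\cdots\times[a_d,b_d]\in\mathcal{C}$ into the $2^d$ hypercubes $I_1\times\cdots\times I_d$ with each $I_j$ equal to $[a_j,(a_j+b_j)/2]$ or $[(a_j+b_j)/2,b_j]$. Interpolant: for a hypercube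 $C'=\prod_{j=1}^d[u_j,u_j+\ell]\subseteq[0,1]^d$ with vertex set $V'=\prod_{j=1}^d\{u_j,u_j+\ell\}$, let $h_{C'}(x):=\sum_{v\in V'}f(v)\prod_{j=1}^d p_{v_j}(x_j)$ for $x\in C'$, where $p_{v_j}(x_j):=1-\frac{x_j-u_j}{\ell}$ if $v_j=u_j$ and $p_{v_j}(x_j):=\frac{x_j-u_j}{\ell}$ if $v_j=u_j+\ell$. BAG algorithm with input $(a,c_1,\gamma_1)$: initialize $D=[0,1]^d$, $\mathcal{C}_0=\{D\}$, $h_D\equiv a$, $n=0$. For iterations $i=1,2,\dots$: set $S(i):=\bigcup_{C\in\mathcal{C}_{i-1}}\{x\in C:|h_C(x)-a|\le c_1d\,2^{-(1+\gamma_1)(i-1)}\}$ and $\mathcal{C}_i':=\mathrm{bisect}(\mathcal{C}_{i-1})$. For each $C'\in\mathcal{C}_i'$, for each vertex $v$ of $C'$: increase $n$ by $1$, query $x_n:=v$, observe $f(x_n)$, output $S_n:=S(i)$; then form the interpolant $h_{C'}$. After all $C'\in\mathcal{C}'_i$ are processed, set $\mathcal{C}_i:=\{C'\in\mathcal{C}_i':\exists x\in C',\ |h_{C'}(x)-a|\le c_1d\,2^{-(1+\gamma_1)i}\}$. *)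

(* Defs.v *)
From HB Require Import structures.
From mathcomp Require Import all_boot all_order all_algebra.
From mathcomp Require Import all_classical all_reals all_analysis.

Set Implicit Arguments.
Unset Strict Implicit.
Unset Printing Implicit Defensive.

Import Order.TTheory GRing.Theory Num.Theory.
Import numFieldNormedType.Exports.
Local Open Scope classical_set_scope.
Local Open Scope ring_scope.

(* Points are row vectors, and `|x| on them is the sup-norm.  A function on
   [0,1]^d is a total function on 'rV_d; no definition below depends on its
   values outside the unit cube. *)

Definition unit_cube (R : realType) (d : nat) : set 'rV[R]_d :=
  [set x | forall j, 0 <= x 0 j <= 1].

Definition level_set (R : realType) (d : nat) (f : 'rV[R]_d -> R) (a : R) :
    set 'rV[R]_d :=
  [set x | unit_cube x /\ f x = a].

(* {|f - a| <= r} *)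
Definition inflated_level_set (R : realType) (d : nat) (f : 'rV[R]_d -> R)
    (a r : R) : set 'rV[R]_d :=
  [set x | unit_cube x /\ `|f x - a| <= r].

Definition is_approximation (R : realType) (d : nat) (f : 'rV[R]_d -> R)
    (a eps : R) (S : set 'rV[R]_d) : Prop :=
  level_set f a `<=` S /\ S `<=` inflated_level_set f a eps.

Definition gradient (R : realType) (d : nat) (f : 'rV[R]_d -> R)
    (x : 'rV[R]_d) : 'rV[R]_d :=
  \row_j 'D_(delta_mx 0 j) f x.

Definition continuously_differentiable (R : realType) (d : nat)
    (f : 'rV[R]_d -> R) : Prop :=
  (forall x, differentiable f x) /\ continuous (gradient f).

Definition gradient_holder (R : realType) (d : nat) (c1 gamma1 : R)
    (E : set 'rV[R]_d) (f : 'rV[R]_d -> R) : Prop :=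
  exists g : 'rV[R]_d -> R,
    [/\ continuously_differentiable g,
        forall x, E x -> f x = g x &
        forall x y, E x -> E y ->
          `|gradient g x - gradient g y| <= c1 * `|x - y| `^ gamma1].

(* The empty set is treated apart because the supremum of no integer would be
   -oo rather than 0. *)
Definition packing_number (R : realType) (d : nat) (E : set 'rV[R]_d) (r : R) :
    \bar R :=
  if `[< E = set0 >] then 0%E
  else ereal_sup [set (k%:R)%:E | k in [set k : nat | (1 <= k)%N /\
         exists x : 'I_k -> 'rV[R]_d, (forall i, E (x i)) /\
           forall i j, i != j -> r < `|x i - x j|]].

Definition NLS_dimension (R : realType) (d : nat) (f : 'rV[R]_d -> R)
    (a dstar : R) : Prop :=
  0 <= dstar /\
  exists2 Cstar : R, 0 < Cstar &
    forall r : R, 0 < r < 1 ->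
      (packing_number (inflated_level_set f a r) r
         <= (Cstar * (1 / r) `^ dstar)%:E)%E.

(* The pair (u, l) stands for the product of the intervals [u_j, u_j + l]. *)
Definition hypercube (R : realType) (d : nat) : Type := ('rV[R]_d * R)%type.

Definition in_hypercube (R : realType) (d : nat) (C : hypercube R d) :
    set 'rV[R]_d :=
  [set x | forall j, C.1 0 j <= x 0 j <= C.1 0 j + C.2].

(* Vertices of a hypercube, and its children under bisection, are indexed by
   s : {ffun 'I_d -> bool}; s j = false selects the lower endpoint (resp. the
   lower half) along coordinate j, and s j = true the upper one. *)
Definition vertex (R : realType) (d : nat) (C : hypercube R d)
    (s : {ffun 'I_d -> bool}) : 'rV[R]_d :=
  \row_j (if s j then C.1 0 j + C.2 else C.1 0 j).

Definition vertices (R : realType) (d : nat) (C : hypercube R d) :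
    seq 'rV[R]_d :=
  [seq vertex C s | s <- enum {ffun 'I_d -> bool}].

Definition child (R : realType) (d : nat) (C : hypercube R d)
    (s : {ffun 'I_d -> bool}) : hypercube R d :=
  (\row_j (if s j then C.1 0 j + C.2 / 2 else C.1 0 j), C.2 / 2).

Definition bisect (R : realType) (d : nat) (Cs : seq (hypercube R d)) :
    seq (hypercube R d) :=
  [seq child C s | C <- Cs, s <- enum {ffun 'I_d -> bool}].

Definition interpolant (R : realType) (d : nat) (f : 'rV[R]_d -> R)
    (C : hypercube R d) (x : 'rV[R]_d) : R :=
  \sum_(s : {ffun 'I_d -> bool}) f (vertex C s) *
    \prod_(j < d) (if s j then (x 0 j - C.1 0 j) / C.2
                   else 1 - (x 0 j - C.1 0 j) / C.2).

(* h_C for C in the family C_i: constant for the initial cube, the interpolant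
   afterwards. *)
Definition local_approximant (R : realType) (d : nat) (a : R)
    (f : 'rV[R]_d -> R) (i : nat) (C : hypercube R d) : 'rV[R]_d -> R :=
  if i is 0%N then fun=> a else interpolant f C.

Definition bag_tolerance (R : realType) (d : nat) (c1 gamma1 : R) (i : nat) :
    R :=
  c1 * d%:R * 2 `^ (- ((1 + gamma1) * i%:R)).

(* The family C_i. *)
Fixpoint bag_family (R : realType) (d : nat) (a c1 gamma1 : R)
    (f : 'rV[R]_d -> R) (i : nat) : seq (hypercube R d) :=
  if i is i'.+1 then
    [seq C <- bisect (bag_family a c1 gamma1 f i') |
      `[< exists2 x, in_hypercube C x &
            `|local_approximant a f i C x - a|
               <= bag_tolerance d c1 gamma1 i >]]
  else [:: (0, 1)].

(* The set S(i), for i >= 1. *)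
Definition bag_candidate (R : realType) (d : nat) (a c1 gamma1 : R)
    (f : 'rV[R]_d -> R) (i : nat) : set 'rV[R]_d :=
  [set x | exists2 C, C \in bag_family a c1 gamma1 f i.-1 &
    in_hypercube C x /\
    `|local_approximant a f i.-1 C x - a| <= bag_tolerance d c1 gamma1 i.-1].

(* The steps "query v, observe f v, output S(i)" of iteration i >= 1.  A vertex
   shared by several cubes is queried once for each of them.  The order chosen
   among the cubes and vertices of an iteration does not affect the outputs. *)
Definition bag_iteration (R : realType) (d : nat) (a c1 gamma1 : R)
    (f : 'rV[R]_d -> R) (i : nat) : seq ('rV[R]_d * R * set 'rV[R]_d) :=
  [seq (v, f v, bag_candidate a c1 gamma1 f i) |
     C <- bisect (bag_family a c1 gamma1 f i.-1), v <- vertices C].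

Definition bag_run (R : realType) (d : nat) (a c1 gamma1 : R)
    (f : 'rV[R]_d -> R) (k : nat) : seq ('rV[R]_d * R * set 'rV[R]_d) :=
  flatten [seq bag_iteration a c1 gamma1 f i | i <- iota 1 k].

(* The set S_n, for n >= 1.  The n-th query occurs within the first n
   iterations, since an iteration makes at least one query as long as the
   current family is nonempty.  The default set0 is read only if the families
   become empty before n queries have been made. *)
Definition bag_output (R : realType) (d : nat) (a c1 gamma1 : R)
    (f : 'rV[R]_d -> R) (n : nat) : set 'rV[R]_d :=
  (nth (0, 0, set0) (bag_run a c1 gamma1 f n) n.-1).2.

Definition log2 (R : realType) (x : R) : R := ln x / ln 2.

Definition query_bound (R : realType) (gamma1 dstar kappa1 kappa2 kappa : R)
    (eps : R) : R :=
  if dstar == 0 then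
    kappa1 + kappa2 * Num.max (log2 (1 / eps `^ (1 / (1 + gamma1)))) 0
  else kappa * (1 / eps `^ (dstar / (1 + gamma1))).

(* Main.v *)
(* On a cube of side l, the convex weights of the multilinear interpolant
   average the first-order Taylor expansions of f at x over the vertices; the
   linear terms cancel and the gradient-Hölder condition bounds the rest by
   c1 d l^(1+gamma1).  With l = 2^-i this is the tolerance of the algorithm, so
   no cube meeting the level set is ever discarded, and every retained cube
   contains a point where |f - a| is at most twice the tolerance, hence at most
   2^-i for large i.  The retained cubes are thus counted by a packing number
   at scale 2^-i, at most a constant times 2^(i dstar), and the total number of
   queries is a geometric sum. *)
Require Import Defs.
From HB Require Import structures.
From mathcomp Require Import all_boot all_order all_algebra.
From mathcomp Require Import all_classical all_reals all_analysis.
From mathcomp Require Import zify ring lra.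

Import Order.TTheory GRing.Theory Num.Theory.
Import numFieldNormedType.Exports.
Local Open Scope classical_set_scope.
Local Open Scope ring_scope.

(** * Sup-norm estimates and first-order Taylor expansion on the unit cube *)

Lemma ler_row_coord (R : realType) (d : nat) (x : 'rV[R]_d) j :
  `|x 0 j| <= `|x|.
Proof.
rewrite -[leRHS]/(mx_norm x) mx_normrE.
exact: (le_bigmax_cond _ (fun ij => `|x ij.1 ij.2|) (j := (0, j))).
Qed.

Lemma row_coordB (R : realType) (d : nat) (x y : 'rV[R]_d) j :
  (x - y) 0 j = x 0 j - y 0 j.
Proof. by rewrite !mxE. Qed.

Lemma row_norm_le (R : realType) (d : nat) (x : 'rV[R]_d) (b : R) :
  0 <= b -> (forall j, `|x 0 j| <= b) -> `|x| <= b.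
Proof.
move=> b0 xb; rewrite -[leLHS]/(mx_norm x) mx_normrE; apply/bigmax_leP.
split => // -[i j] _ /=.
by rewrite ord1.
Qed.

Lemma is_derive_line (R : realType) (d : nat) (g : 'rV[R]_d -> R)
    (x v : 'rV[R]_d) (t : R) :
  differentiable g (x + t *: v) ->
  is_derive t 1 (fun s => g (x + s *: v))
    (\sum_j v 0 j * gradient g (x + t *: v) 0 j).
Proof.
move=> dg; set z := x + t *: v.
have E : 'D_v g z = \sum_j v 0 j * gradient g z 0 j.
  rewrite deriveE // {1}(row_sum_delta v) raddf_sum; apply: eq_bigr => j _.
  rewrite mxE [in RHS]deriveE //. exact: linearZ.
(* The difference quotient of the restriction at [t] is that of [g] at [z] in direction [v], so
   derivability and the value of the derivative both transfer. *)
have F : (fun h : R => h^-1 *: (((fun s => g (x + s *: v)) \o shift t) (h *: 1)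
             - g (x + t *: v))) =
         (fun h : R => h^-1 *: ((g \o shift z) (h *: v) - g z)).
  apply: funext => h /=; rewrite /z.
  by rewrite [h *: 1]mulr1 scalerDl [x + (_ + _)]addrCA.
split; first by rewrite /derivable F; exact: diff_derivable.
by rewrite -E /derive F.
Qed.

Lemma unit_cube_line (R : realType) (d : nat) (x y : 'rV[R]_d) (t : R) :
  0 <= t <= 1 -> unit_cube x -> unit_cube y -> unit_cube (x + t *: (y - x)).
Proof.
move=> t01 Ux Uy j; rewrite !mxE; have := Ux j; have := Uy j.
by move=> /andP[? ?] /andP[? ?]; apply/andP; split; nra.
Qed.

(** The mean value theorem on the segment from [x] to [y] yields the gradient at an intermediate
    point [z], which is in the cube by convexity. Subtracting the gradient at [x] leaves [d]
    coordinate terms, each at most l times c1 l^gamma1. *)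
Lemma gradient_holder_taylor (R : realType) (d : nat) (c1 gamma1 l : R)
    (g : 'rV[R]_d -> R) (x y : 'rV[R]_d) :
  0 <= c1 -> 0 < gamma1 ->
  (forall z, differentiable g z) ->
  (forall z w, unit_cube z -> unit_cube w ->
     `|gradient g z - gradient g w| <= c1 * `|z - w| `^ gamma1) ->
  unit_cube x -> unit_cube y -> `|y - x| <= l ->
  `|g y - g x - \sum_j (y - x) 0 j * gradient g x 0 j|
    <= c1 * d%:R * l `^ (1 + gamma1).
Proof.
move=> c0 g0 dg hg Ux Uy yxl.
have l0 : 0 <= l by exact: le_trans yxl.
pose phi (t : R) : R := g (x + t *: (y - x)).
pose dphi (t : R) : R := \sum_j (y - x) 0 j * gradient g (x + t *: (y - x)) 0 j.
have Dphi (t : R) : is_derive t 1 phi (dphi t) by exact: is_derive_line.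
have [|t] := @MVT_segment R phi dphi 0 1 ler01.
  apply: continuous_subspaceT => t.
  apply: differentiable_continuous; apply/derivable1_diffP.
  exact: (@ex_derive _ _ _ _ _ _ _ (Dphi t)).
rewrite in_itv /= => t01.
have -> : phi 1 = g y by rewrite /phi scale1r addrC subrK.
have -> : phi 0 = g x by rewrite /phi scale0r addr0.
rewrite subr0 mulr1 => ->; rewrite /dphi; set z := x + t *: (y - x).
have Uz : unit_cube z by exact: unit_cube_line.
have zx : `|z - x| <= l.
  rewrite /z addrC addKr normrZ; case/andP: t01 => t0 t1.
  rewrite (ger0_norm t0); apply: le_trans yxl.
  by rewrite ler_piMl.
rewrite -sumrB; apply: le_trans (ler_norm_sum _ _ _) _.
have -> : c1 * d%:R * l `^ (1 + gamma1) =
    \sum_(j < d) (l * (c1 * l `^ gamma1)).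
  rewrite sumr_const card_ord powRD ?powRr1 //; last first.
    by apply/implyP => /eqP; lra.
  by rewrite -mulr_natl; ring.
apply: ler_sum => j _; rewrite -mulrBr normrM.
apply: ler_pM => //; first exact: le_trans (ler_row_coord _ _ _ _) yxl.
have := ler_row_coord _ _ (gradient g z - gradient g x) j.
rewrite row_coordB => /le_trans; apply.
apply: le_trans (hg _ _ Uz Ux) _; apply: ler_wpM2l => //.
by apply: ge0_ler_powR; rewrite ?nnegrE ?(ltW g0).
Qed.

(** * Error of multilinear interpolation, and a global bound on [f] *)

Definition interpolant_weight (R : realType) (d : nat) (C : hypercube R d)
    (x : 'rV[R]_d) (s : {ffun 'I_d -> bool}) : R :=
  \prod_(j < d) (if s j then (x 0 j - C.1 0 j) / C.2
                 else 1 - (x 0 j - C.1 0 j) / C.2).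

Lemma interpolant_weight_ge0 (R : realType) (d : nat) (C : hypercube R d) x s :
  0 < C.2 -> in_hypercube C x -> 0 <= interpolant_weight R d C x s.
Proof.
move=> l0 Cx; apply: prodr_ge0 => j _; have /andP[h1 h2] := Cx j.
case: ifP => _; first by apply: divr_ge0; rewrite ?subr_ge0 // ltW.
by rewrite subr_ge0 ler_pdivrMr // mul1r lerBlDl.
Qed.

Lemma sum_interpolant_weight (R : realType) (d : nat) (C : hypercube R d) x :
  \sum_s interpolant_weight R d C x s = 1.
Proof.
rewrite -(bigA_distr_bigA (fun j (b : bool) =>
  if b then (x 0 j - C.1 0 j) / C.2 else 1 - (x 0 j - C.1 0 j) / C.2)).
by apply: big1 => j _; rewrite big_bool /=; ring.
Qed.

(** Multilinear interpolation reproduces the coordinate functions exactly; this is what cancels the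
    linear Taylor terms. *)
Lemma sum_interpolant_weight_vertex (R : realType) (d : nat)
    (C : hypercube R d) x k :
  0 < C.2 ->
  \sum_s interpolant_weight R d C x s * (vertex C s - x) 0 k = 0.
Proof.
move=> l0.
pose t j := (x 0 j - C.1 0 j) / C.2.
pose w j (b : bool) := if b then t j else 1 - t j.
(* Coordinate [k] of a vertex depends on [s k] alone, so it is absorbed into the [k]-th factor.
   Distributivity then gives a product whose [k]-th factor is t (u + l - x) + (1 - t) (u - x) = 0,
   where t = (x - u) / l. *)
pose F j b := if j == k then w j b * (C.1 0 k + b%:R * C.2 - x 0 k) else w j b.
transitivity (\sum_(s : {ffun 'I_d -> bool}) \prod_j F j (s j)).
  apply: eq_bigr => s _; rewrite /interpolant_weight (bigD1 k) //=.
  rewrite [in RHS](bigD1 k) //= {1}/F eqxx /w -/(t k) mulrAC.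
  congr (_ * _ * _); last first.
    by apply: eq_bigr => j /negPf jk; rewrite /F jk.
  by rewrite !mxE; case: (s k); rewrite ?mul1r ?mul0r ?addr0.
rewrite -(bigA_distr_bigA F) (bigD1 k) //= big_bool /F eqxx /w /t.
by rewrite [X in X * _](_ : _ = 0) ?mul0r //=; field; rewrite gt_eqF.
Qed.

Lemma interpolant_error (R : realType) (d : nat) (c1 gamma1 : R)
    (f : 'rV[R]_d -> R) (C : hypercube R d) x :
  0 <= c1 -> 0 < gamma1 -> gradient_holder c1 gamma1 (@unit_cube R d) f ->
  0 < C.2 -> in_hypercube C `<=` @unit_cube R d -> in_hypercube C x ->
  `|interpolant f C x - f x| <= c1 * d%:R * C.2 `^ (1 + gamma1).
Proof.
move=> c0 g0 [g [[dg _] fg hg]] l0 CU Cx.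
have Cv s : in_hypercube C (vertex C s).
  move=> j; rewrite mxE; case: ifP => _; rewrite lexx ?andbT //= lerDl ltW //.
have vx s : `|vertex C s - x| <= C.2.
  apply: row_norm_le => [|j]; first exact: ltW.
  rewrite row_coordB; have := Cv s j; have := Cx j.
  by move=> /andP[? ?] /andP[? ?]; rewrite ler_norml; apply/andP; split; lra.
pose D s := g (vertex C s) - g x -
  \sum_j (vertex C s - x) 0 j * gradient g x 0 j.
have Ux := CU _ Cx.
have -> : interpolant f C x - f x = \sum_s interpolant_weight R d C x s * D s.
  have -> : interpolant f C x =
      \sum_s interpolant_weight R d C x s * g (vertex C s).
    by apply: eq_bigr => s _; rewrite mulrC fg //; apply: CU.
  have h0 : \sum_s interpolant_weight R d C x s *
      \sum_j (vertex C s - x) 0 j * gradient g x 0 j = 0.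
    under eq_bigr => s _ do rewrite mulr_sumr.
    rewrite exchange_big /= big1 // => j _.
    under eq_bigr => s _ do rewrite mulrA.
    by rewrite -mulr_suml sum_interpolant_weight_vertex // mul0r.
  under [RHS]eq_bigr => s _ do rewrite /D mulrBr mulrBr.
  by rewrite !sumrB h0 subr0 -mulr_suml sum_interpolant_weight mul1r (fg _ Ux).
apply: le_trans (ler_norm_sum _ _ _) _.
rewrite -[leRHS]mul1r -{1}(sum_interpolant_weight R d C x) mulr_suml.
apply: ler_sum => s _; rewrite normrM.
rewrite (ger0_norm (interpolant_weight_ge0 _ _ _ _ s l0 Cx)).
apply: ler_wpM2l; first exact: interpolant_weight_ge0.
exact: (gradient_holder_taylor R d c1 gamma1 C.2 g x (vertex C s)
  c0 g0 dg hg Ux (CU _ (Cv s)) (vx s)).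
Qed.

(** Serves the first iteration, where the approximant is the constant [a] and no interpolation
    estimate is available. Expanding at the corner 0 with l = 1 gives the bound. *)
Lemma gradient_holder_bounded (R : realType) (d : nat) (c1 gamma1 : R)
    (f : 'rV[R]_d -> R) (a : R) :
  0 <= c1 -> 0 < gamma1 -> gradient_holder c1 gamma1 (@unit_cube R d) f ->
  exists M, forall x, unit_cube x -> `|f x - a| <= M.
Proof.
move=> c0 g0 [g [[dg _] fg hg]].
have U0 : unit_cube (0 : 'rV[R]_d) by move=> j; rewrite mxE lexx ler01.
exists (`|g 0 - a| + (c1 * d%:R + \sum_j `|gradient g 0 0 j|)) => x Ux.
have xn j : `|(x - 0) 0 j| <= 1.
  by rewrite subr0; have /andP[x0 x1] := Ux j; rewrite ger0_norm.
have := gradient_holder_taylor R d c1 gamma1 1 g 0 x c0 g0 dg hg U0 Ux.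
rewrite powR1 mulr1 => /(_ (row_norm_le _ _ _ _ ler01 xn)) hx.
rewrite (fg _ Ux); set S := \sum_j _ in hx.
have hS : `|S| <= \sum_j `|gradient g 0 0 j|.
  apply: le_trans (ler_norm_sum _ _ _) _; apply: ler_sum => j _.
  by rewrite normrM ler_piMl.
have -> : g x - a = (g 0 - a) + ((g x - g 0 - S) + S) by ring.
apply: le_trans (ler_normD _ _) _; apply: lerD => //.
by apply: le_trans (ler_normD _ _) _; apply: lerD.
Qed.

(** * Dyadic cubes with integer indices *)

Definition grid_cube (R : realType) (d i : nat) (m : {ffun 'I_d -> nat}) :
    hypercube R d :=
  (\row_j ((m j)%:R * 2^-1 ^+ i), 2^-1 ^+ i).

Definition child_code (d : nat) (m : {ffun 'I_d -> nat})
    (s : {ffun 'I_d -> bool}) : {ffun 'I_d -> nat} :=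
  [ffun j => (s j + (m j).*2)%N].

Lemma child_grid_cube (R : realType) (d i : nat) m s :
  child (grid_cube R d i m) s = grid_cube R d i.+1 (child_code d m s).
Proof.
rewrite /child /grid_cube /= exprSr; congr (_, _).
apply/rowP => j; rewrite !mxE ffunE natrD -muln2 natrM.
by case: (s j) => /=; field.
Qed.

(** The bits [s] are the last binary digits of the new index and [m] holds the others, so halving
    and parity recover both. *)
Lemma child_code_inj (d : nat) m m' s s' :
  child_code d m s = child_code d m' s' -> (m, s) = (m', s').
Proof.
move/ffunP => E; congr (_, _); apply/ffunP => j; have := E j; rewrite !ffunE.
  by move/(congr1 half); rewrite !half_bit_double.
move/(congr1 odd); rewrite !oddD !odd_double !addbF.
by case: (s j); case: (s' j).
Qed.

(** Distinct indices let the size of a family be compared with a packing number; the bound on the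
    indices keeps the cubes inside the unit cube. *)
Lemma bag_family_grid (R : realType) (d : nat) (a c1 gamma1 : R)
    (f : 'rV[R]_d -> R) i :
  exists ms : seq {ffun 'I_d -> nat},
    [/\ uniq ms,
        bag_family a c1 gamma1 f i = [seq grid_cube R d i m | m <- ms] &
        forall m, m \in ms -> forall j, (m j < 2 ^ i)%N].
Proof.
elim: i => [|i [ms [Ums E ltms]]].
  exists [:: [ffun=> 0%N]]; split => //=.
    by congr [:: (_, _)]; apply/rowP => j; rewrite !mxE ffunE mul0r.
  by move=> m; rewrite inE => /eqP -> j; rewrite ffunE.
rewrite /= E.
pose cs := [seq child_code d m s | m <- ms, s <- enum {ffun 'I_d -> bool}].
have -> : bisect [seq grid_cube R d i m | m <- ms] =
          [seq grid_cube R d i.+1 m | m <- cs].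
  rewrite /bisect /cs allpairs_mapl map_allpairs.
  by apply: eq_allpairs => m s; rewrite child_grid_cube.
rewrite filter_map; eexists; split; last 2 first.
- reflexivity.
- move=> m; rewrite mem_filter => /andP[_] /allpairsP[[m' s] /= [m'ms _ ->]] j.
  have := ltms _ m'ms j; rewrite ffunE expnS mul2n -!muln2.
  by case: (s j) => /=; lia.
apply: filter_uniq; apply: allpairs_uniq => //; first exact: enum_uniq.
by move=> [m s] [m' s'] _ _ /= /child_code_inj.
Qed.

Lemma size_bisect (R : realType) (d : nat) (Cs : seq (hypercube R d)) :
  size (bisect Cs) = (size Cs * 2 ^ d)%N.
Proof. by rewrite size_allpairs -cardE card_ffun card_bool card_ord. Qed.

(** Crude count for the finitely many early iterations, whose tolerance is too large for the packing
    argument. *)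
Lemma size_bag_family (R : realType) (d : nat) (a c1 gamma1 : R)
    (f : 'rV[R]_d -> R) i :
  (size (bag_family a c1 gamma1 f i) <= (2 ^ d) ^ i)%N.
Proof.
elim: i => // i IH /=; rewrite size_filter.
apply: leq_trans (count_size _ _) _.
by rewrite size_bisect expnSr leq_mul2r IH orbT.
Qed.

Lemma grid_cube_sub (R : realType) (d i : nat) (m : {ffun 'I_d -> nat}) :
  (forall j, (m j < 2 ^ i)%N) ->
  in_hypercube (grid_cube R d i m) `<=` @unit_cube R d.
Proof.
move=> mi x Cx j; have := Cx j; rewrite /= !mxE => /andP[h1 h2].
have p : 0 <= 2^-1 ^+ i :> R by rewrite exprn_ge0 // invr_ge0.
apply/andP; split; first by apply: le_trans h1; rewrite mulr_ge0.
apply: le_trans h2 _; rewrite -[X in _ + X]mul1r -mulrDl natr1.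
have E : (2 ^ i)%:R * 2^-1 ^+ i = 1 :> R.
  by rewrite natrX -exprMn mulfV ?expr1n // pnatr_eq0.
by rewrite -[leRHS]E ler_wpM2r // ler_nat.
Qed.

Lemma bag_family_sub (R : realType) (d : nat) (a c1 gamma1 : R)
    (f : 'rV[R]_d -> R) i C :
  C \in bag_family a c1 gamma1 f i ->
  C.2 = 2^-1 ^+ i /\ in_hypercube C `<=` @unit_cube R d.
Proof.
have [ms [_ -> ltms]] := bag_family_grid R d a c1 gamma1 f i.
by move=> /mapP[m mms ->]; split => //; apply: grid_cube_sub; apply: ltms.
Qed.

Lemma child_cover (R : realType) (d : nat) (C : hypercube R d) x :
  in_hypercube C x -> exists s, in_hypercube (child C s) x.
Proof.
move=> Cx; exists [ffun j => C.1 0 j + C.2 / 2 <= x 0 j] => j.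
rewrite !mxE ffunE; have /andP[h1 h2] := Cx j.
by case: (leP (C.1 0 j + C.2 / 2) (x 0 j)) => h /=; apply/andP; split; lra.
Qed.

Lemma bag_toleranceE (R : realType) (d : nat) (c1 gamma1 : R) i :
  bag_tolerance d c1 gamma1 i = c1 * d%:R * (2^-1 ^+ i) `^ (1 + gamma1).
Proof.
rewrite /bag_tolerance exprVn -powR_invn ?ler0n // -powRrM.
by congr (_ * _ `^ _); ring.
Qed.

(** * Accuracy of the candidate sets *)

Section Bag.
Variables (R : realType) (d : nat) (a c1 gamma1 : R) (f : 'rV[R]_d -> R).
Hypotheses (c1_ge0 : 0 <= c1) (gamma1_gt0 : 0 < gamma1).
Hypothesis f_holder : gradient_holder c1 gamma1 (@unit_cube R d) f.

Lemma bag_tolerance_ge0 i : 0 <= bag_tolerance d c1 gamma1 i.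
Proof. by rewrite !mulr_ge0 // powR_ge0. Qed.

Lemma local_approximant_error i C x :
  (0 < i)%N -> C.2 = 2^-1 ^+ i -> in_hypercube C `<=` @unit_cube R d ->
  in_hypercube C x ->
  `|local_approximant a f i C x - f x| <= bag_tolerance d c1 gamma1 i.
Proof.
case: i => // i _ C2 CU Cx; rewrite bag_toleranceE -C2.
by apply: interpolant_error => //; rewrite C2 exprn_gt0 // invr_gt0.
Qed.

Lemma local_approximant_close i C x :
  (0 < i)%N -> C \in bag_family a c1 gamma1 f i -> in_hypercube C x ->
  `|local_approximant a f i C x - a| <= bag_tolerance d c1 gamma1 i ->
  `|f x - a| <= 2 * bag_tolerance d c1 gamma1 i.
Proof.
move=> i0 Ci Cx h; have [C2 CU] := bag_family_sub _ _ _ _ _ _ _ _ Ci.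
have := local_approximant_error i C x i0 C2 CU Cx.
rewrite ler_norml => /andP[h1 h2]; move: h; rewrite ler_norml => /andP[h3 h4].
by rewrite ler_norml; apply/andP; split; lra.
Qed.

(** By induction, a retained cube containing [x] has a child containing [x]. The approximant of that
    child at [x] is within the tolerance of [f x = a], so [x] itself witnesses that the child is
    kept. *)
Lemma bag_family_level_set i x : level_set f a x ->
  exists2 C, C \in bag_family a c1 gamma1 f i & in_hypercube C x /\
    `|local_approximant a f i C x - a| <= bag_tolerance d c1 gamma1 i.
Proof.
move=> [Ux fx]; elim: i => [|i [C Ci [Cx _]]].
  exists (0, 1); rewrite ?inE //; split; last first.
    by rewrite subrr normr0 bag_tolerance_ge0.
  by move=> j; rewrite /= mxE add0r.
have [C2 CU] := bag_family_sub _ _ _ _ _ _ _ _ Ci.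
have [s sx] := child_cover _ _ _ _ Cx.
have sb : child C s \in bisect (bag_family a c1 gamma1 f i).
  by apply: allpairs_f => //; rewrite mem_enum.
have happ : `|local_approximant a f i.+1 (child C s) x - a|
    <= bag_tolerance d c1 gamma1 i.+1.
  rewrite -{2}fx; apply: local_approximant_error => //.
    by rewrite /= C2 exprSr.
  move=> y sy; apply: CU => j; have := sy j; rewrite !mxE /=.
  have p : 0 <= C.2 by rewrite C2 exprn_ge0 // invr_ge0.
  by case: (s j) => /andP[? ?]; apply/andP; split; lra.
exists (child C s) => //=; rewrite mem_filter sb andbT.
by apply/asboolP; exists x.
Qed.

Lemma bag_candidate_approximation M i :
  (forall x, unit_cube x -> `|f x - a| <= M) ->
  is_approximation f a
    (Num.max (2 * (c1 * d%:R)) M * (2^-1 ^+ i) `^ (1 + gamma1))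
    (bag_candidate a c1 gamma1 f i.+1).
Proof.
move=> fM; split; first by move=> x /bag_family_level_set; apply.
move=> x [C Ci [Cx hC]]; have [C2 CU] := bag_family_sub _ _ _ _ _ _ _ _ Ci.
split; first exact: CU.
(* For the initial cube only the global bound [M] is available; afterwards the error is at most
   twice the tolerance. The maximum covers both cases. *)
case: i Ci hC {C2} => [|i] Ci hC.
  by rewrite expr0 powR1 mulr1 le_max fM ?orbT //; apply: CU.
apply: le_trans (local_approximant_close _ _ _ _ Ci Cx hC) _ => //.
by rewrite bag_toleranceE mulrA ler_wpM2r ?powR_ge0 // le_max lexx.
Qed.

End Bag.

(** * Counting the retained cubes by packing numbers *)

Lemma powR_exprn (R : realType) (x y : R) n :
  0 <= x -> (x ^+ n) `^ y = (x `^ y) ^+ n.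
Proof.
move=> x0.
by rewrite -(powR_mulrn n x0) -(powR_mulrn n (powR_ge0 _ _)) powRAC.
Qed.

Lemma exists_expr_gt (R : realType) (q x : R) : 1 < q -> exists n, x < q ^+ n.
Proof.
move=> q1; have q0 : 0 < q - 1 by rewrite subr_gt0.
have bernoulli n : 1 + n%:R * (q - 1) <= q ^+ n.
  elim: n => [|n IH]; first by rewrite mul0r addr0.
  rewrite exprSr -natr1; have qp : 0 <= q by lra.
  apply: le_trans (ler_wpM2r qp IH).
  have -> : (1 + n%:R * (q - 1)) * q =
      1 + (n%:R + 1) * (q - 1) + n%:R * (q - 1) ^+ 2 by ring.
  by rewrite lerDl mulr_ge0 // sqr_ge0.
exists (Num.bound (`|x| / (q - 1))).
apply: lt_le_trans (bernoulli _); apply: ltr_wpDl => //.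
apply: le_lt_trans (ler_norm _) _; rewrite -ltr_pdivrMr //.
by apply: archi_boundP; rewrite divr_ge0 // ltW.
Qed.

Lemma size_partition_classes (T : eqType) (I : finType) (cl : T -> I)
    (s : seq T) :
  size s = (\sum_(c : I) count (fun x => cl x == c) s)%N.
Proof.
rewrite -sum1_size (partition_big cl xpredT) //=.
by apply: eq_bigr => c _; rewrite sum1_count.
Qed.

Lemma packing_number_ge (R : realType) (d : nat) (E : set 'rV[R]_d) (r : R) k
    (x : 'I_k -> 'rV[R]_d) :
  (0 < k)%N -> (forall i, E (x i)) ->
  (forall i j, i != j -> r < `|x i - x j|) ->
  ((k%:R)%:E <= packing_number E r)%E.
Proof.
case: k x => // k x _ Ex xr; rewrite /packing_number; case: asboolP => [E0|_].
  by have := Ex ord0; rewrite E0.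
by apply: ereal_sup_ubound; exists k.+1 => //; split => //; exists x.
Qed.

(** Distinct congruent indices differ by at least 3 in some coordinate, leaving a gap of at least
    two sides between the cubes. Modulus 2 would only ensure a gap of one side, whereas a packing
    asks for strictly more. *)
Lemma grid_cube_separated (R : realType) (d i : nat)
    (m m' : {ffun 'I_d -> nat}) x x' :
  (forall j, m j = m' j %[mod 3]) -> m != m' ->
  in_hypercube (grid_cube R d i m) x -> in_hypercube (grid_cube R d i m') x' ->
  2^-1 ^+ i < `|x - x'|.
Proof.
move=> mod3 mm' Cx Cx'.
have p : 0 < 2^-1 ^+ i :> R by rewrite exprn_gt0 // invr_gt0.
have [j mj] : exists j, m j != m' j.
  apply/existsP; apply: contraR mm' => /existsPn h.
  by apply/eqP/ffunP => j; apply/eqP; rewrite -[_ == _]negbK h.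
apply: lt_le_trans (ler_row_coord _ _ _ j); rewrite row_coordB.
have := Cx j; have := Cx' j; rewrite !mxE /= => /andP[a1 a2] /andP[b1 b2].
have [lt|lt] : ((m j + 3 <= m' j) \/ (m' j + 3 <= m j))%N.
- by have := mod3 j; move/eqP: mj; lia.
- rewrite ltr_normr; apply/orP; right.
  have : (m j)%:R + 3 <= (m' j)%:R :> R by rewrite -natrD ler_nat.
  by move/(ler_wpM2r (ltW p)); lra.
- rewrite ltr_normr; apply/orP; left.
  have : (m' j)%:R + 3 <= (m j)%:R :> R by rewrite -natrD ler_nat.
  by move/(ler_wpM2r (ltW p)); lra.
Qed.

(* Points taken in distinct grid cubes need not be far apart, but they are when
   the cube indices agree modulo 3; this costs a factor 3 ^ d. *)
Lemma size_grid_family (R : realType) (d i : nat) (E : set 'rV[R]_d) (N : R)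
    (ms : seq {ffun 'I_d -> nat}) :
  uniq ms -> 0 <= N -> (packing_number E (2^-1 ^+ i) <= N%:E)%E ->
  (forall m, m \in ms -> exists2 x, in_hypercube (grid_cube R d i m) x & E x) ->
  (size ms)%:R <= (3 ^ d)%:R * N.
Proof.
move=> Ums N0 EN msE.
pose cl (m : {ffun 'I_d -> nat}) : {ffun 'I_d -> 'I_3} :=
  [ffun j => inord (m j %% 3)].
rewrite (size_partition_classes _ _ cl) natr_sum.
have -> : (3 ^ d)%:R * N = \sum_(c : {ffun 'I_d -> 'I_3}) N.
  by rewrite sumr_const card_ffun !card_ord mulr_natl.
apply: ler_sum => c _; rewrite -size_filter.
set s := seq.filter _ ms; have [->//|s0] := posnP (size s).
have sE (k : 'I_(size s)) :
    exists2 x, in_hypercube (grid_cube R d i (nth [ffun=> 0%N] s k)) x & E x.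
  apply: msE; have : nth [ffun=> 0%N] s k \in s by rewrite mem_nth.
  by rewrite mem_filter => /andP[].
have [x xC xE] : exists2 x : 'I_(size s) -> 'rV[R]_d,
    (forall k : 'I_(size s),
       in_hypercube (grid_cube R d i (nth [ffun=> 0%N] s k)) (x k)) &
    forall k, E (x k).
  by exists (fun k => s2val (cid2 (sE k))) => k; case: cid2.
rewrite -lee_fin; apply: le_trans EN.
apply: (packing_number_ge _ _ _ _ _ x) => // k k' kk'.
apply: grid_cube_separated (xC k) (xC k') => [j|].
  have scl (l : 'I_(size s)) : cl (nth [ffun=> 0%N] s l) = c.
    have : nth [ffun=> 0%N] s l \in s by rewrite mem_nth.
    by rewrite mem_filter => /andP[/eqP].
  have /ffunP/(_ j)/(congr1 val) := etrans (scl k) (esym (scl k')).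
  by rewrite !ffunE /= !inordK // ltn_mod.
by rewrite nth_uniq ?filter_uniq.
Qed.

Lemma size_bag_family_packing (R : realType) (d : nat) (a c1 gamma1 : R)
    (f : 'rV[R]_d -> R) (dstar : R) :
  0 <= c1 -> 0 < gamma1 -> gradient_holder c1 gamma1 (@unit_cube R d) f ->
  NLS_dimension f a dstar ->
  exists2 K : R, 0 <= K & forall i,
    (size (bag_family a c1 gamma1 f i))%:R <= K * (2 `^ dstar) ^+ i.
Proof.
move=> c0 g0 hf [ds0 [Cs Cs0 hN]].
have pw1 : 1 <= 2 `^ dstar :> R.
  by rewrite -[leLHS](powRr0 2) ler_powR // ler1n.
(* Beyond [i0], twice the tolerance is at most 2^-i, so the packing bound applies at r = 2^-i. The
   two summands of the witness below handle the iterations after [i0] and those up to [i0]. *)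
have [i0 hi0] : exists i0, 2 * (c1 * d%:R) < (2 `^ gamma1) ^+ i0.
  apply: exists_expr_gt; have := @gt0_ltr_powR R _ g0 1 2.
  by rewrite powR1 !nnegrE ltr1n; apply.
have KB : 0 <= ((2 ^ d) ^ i0.+1)%:R :> R by [].
have KA : 0 <= (3 ^ d)%:R * Cs :> R by rewrite mulr_ge0 // ltW.
exists ((3 ^ d)%:R * Cs + ((2 ^ d) ^ i0.+1)%:R) => [|i].
  by rewrite addr_ge0.
have pi : 1 <= (2 `^ dstar) ^+ i :> R by rewrite exprn_ege1.
have [ii0|ii0] := leqP i i0.
  apply: (@le_trans _ _ ((2 ^ d) ^ i0.+1)%:R).
    rewrite ler_nat; apply: leq_trans (size_bag_family _ _ _ _ _ _ _) _.
    by rewrite leq_pexp2l ?expn_gt0 // ltnW.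
  rewrite mulrDl -[leLHS]mulr1; apply: ler_wpDl; last exact: ler_wpM2l.
  by rewrite mulr_ge0 // (le_trans ler01).
apply: (@le_trans _ _ ((3 ^ d)%:R * (Cs * (2 `^ dstar) ^+ i))); last first.
  by rewrite mulrA ler_wpM2r ?lerDl // (le_trans ler01).
have [ms [Ums E _]] := bag_family_grid R d a c1 gamma1 f i.
have r01 : 0 < (2^-1 ^+ i : R) < 1.
  rewrite exprn_gt0 ?invr_gt0 //= exprn_ilt1 ?invr_ge0 ?invf_lt1 ?ltr1n //.
  by case: (i) ii0.
have := hN _ r01.
have -> : (1 / 2^-1 ^+ i) `^ dstar = (2 `^ dstar) ^+ i.
  by rewrite mul1r exprVn invrK powR_exprn.
have -> : size (bag_family a c1 gamma1 f i) = size ms by rewrite E size_map.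
move=> hp; apply: (size_grid_family _ _ i _ _ ms Ums _ hp).
  by rewrite mulr_ge0 ?ltW // (lt_le_trans ltr01).
move=> m mms.
have mF : grid_cube R d i m \in bag_family a c1 gamma1 f i by rewrite E map_f.
have i_gt0 : (0 < i)%N by case: (i) ii0.
have [x xm hx] : exists2 x, in_hypercube (grid_cube R d i m) x &
    `|local_approximant a f i (grid_cube R d i m) x - a|
      <= bag_tolerance d c1 gamma1 i.
  move: mF; clear -i_gt0; case: i i_gt0 m => // i _ m.
  by rewrite [bag_family _ _ _ _ _]/= mem_filter => /andP[/asboolP].
exists x => //; split.
  by have [_] := bag_family_sub _ _ _ _ _ _ _ _ mF; apply.
have := local_approximant_close _ _ _ _ _ _ c0 g0 hf _ _ _ i_gt0 mF xm hx.
move=> /le_trans; apply.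
(* After one factor 2^-i is cancelled, the claim is 2 c1 d <= (2^gamma1)^i, which follows from the
   choice of [i0]. *)
have p : 0 < 2^-1 ^+ i :> R by rewrite exprn_gt0 // invr_gt0.
rewrite bag_toleranceE powRD; last by apply/implyP => /eqP; lra.
rewrite (powRr1 (ltW p)) mulrA [2 * _ * _]mulrCA -[leRHS]mulr1 ler_pM2l //.
rewrite powR_exprn ?invr_ge0 // -powR_inv1 // powRAC.
rewrite powR_inv1 ?powR_ge0 // exprVn.
rewrite ler_pdivrMr ?exprn_gt0 ?powR_gt0 // mul1r.
apply: le_trans (ltW hi0) _; apply: ler_weXn2l; last exact: ltnW.
by rewrite -[leLHS](powRr0 2) ler_powR ?(ltW g0) // ler1n.
Qed.

(** * Counting queries and locating outputs *)

Lemma bag_family_neq0 (R : realType) (d : nat) (a c1 gamma1 : R)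
    (f : 'rV[R]_d -> R) i :
  0 <= c1 -> 0 < gamma1 -> gradient_holder c1 gamma1 (@unit_cube R d) f ->
  level_set f a !=set0 -> (0 < size (bag_family a c1 gamma1 f i))%N.
Proof.
move=> c0 g0 hf [x Lx].
have [C Ci _] := bag_family_level_set _ _ _ _ _ _ c0 g0 hf i x Lx.
by case: (bag_family _ _ _ _ _) Ci.
Qed.

(** Each cube has 2^d children with 2^d vertices each, and shared vertices are counted with
    repetition. *)
Lemma size_bag_iteration (R : realType) (d : nat) (a c1 gamma1 : R)
    (f : 'rV[R]_d -> R) i :
  size (bag_iteration a c1 gamma1 f i.+1)
    = (4 ^ d * size (bag_family a c1 gamma1 f i))%N.
Proof.
rewrite /bag_iteration size_allpairs_dep.
have E (Cs : seq (hypercube R d)) :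
    sumn [seq size (vertices C) | C <- Cs] = (size Cs * 2 ^ d)%N.
  elim: Cs => //= C Cs ->.
  by rewrite size_map -cardE card_ffun card_bool card_ord mulSn.
by rewrite E size_bisect -mulnA -expnMn mulnC.
Qed.

Lemma size_bag_run (R : realType) (d : nat) (a c1 gamma1 : R)
    (f : 'rV[R]_d -> R) k :
  size (bag_run a c1 gamma1 f k)
    = (4 ^ d * \sum_(i < k) size (bag_family a c1 gamma1 f i))%N.
Proof.
rewrite /bag_run size_flatten /shape -map_comp.
elim: k => [|k IH]; first by rewrite big_ord0 muln0.
rewrite -[X in iota _ X]addn1 iotaD map_cat sumn_cat IH.
rewrite big_ord_recr /= mulnDr addn0.
by rewrite size_bag_iteration.
Qed.

Lemma mem_bag_run (R : realType) (d : nat) (a c1 gamma1 : R)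
    (f : 'rV[R]_d -> R) k l p n :
  (size (bag_run a c1 gamma1 f k) <= n
    < size (bag_run a c1 gamma1 f (k + l)))%N ->
  exists2 j, (k <= j)%N &
    (nth p (bag_run a c1 gamma1 f (k + l)) n).2
      = bag_candidate a c1 gamma1 f j.+1.
Proof.
have -> : bag_run a c1 gamma1 f (k + l) = bag_run a c1 gamma1 f k ++
    flatten [seq bag_iteration a c1 gamma1 f i | i <- iota k.+1 l].
  by rewrite /bag_run iotaD map_cat flatten_cat.
rewrite size_cat nth_cat => /andP[kn nl]; rewrite ltnNge kn /=.
set run := flatten _ in nl *.
pose P (q : 'rV[R]_d * R * set 'rV[R]_d) :=
  `[< exists2 j, (k <= j)%N & q.2 = bag_candidate a c1 gamma1 f j.+1 >].
have allP k' : (k <= k')%N ->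
    all P (flatten [seq bag_iteration a c1 gamma1 f i | i <- iota k'.+1 l]).
  elim: (l) k' => //= l' IH k' kk'; rewrite all_cat IH ?leqW // andbT.
  by apply/all_allpairsP => C v _ _; apply/asboolP; exists k'.
(* Every entry after the first [k] iterations was produced by some iteration [j.+1] with
   [k <= j]. *)
have /all_nthP : all P run by exact: allP.
by move=> /(_ p _ _)/asboolP; apply; rewrite ltn_subLR.
Qed.

Lemma bag_output_candidate (R : realType) (d : nat) (a c1 gamma1 : R)
    (f : 'rV[R]_d -> R) k n :
  0 <= c1 -> 0 < gamma1 -> gradient_holder c1 gamma1 (@unit_cube R d) f ->
  level_set f a !=set0 -> (size (bag_run a c1 gamma1 f k) < n)%N ->
  exists2 j, (k <= j)%N &
    bag_output a c1 gamma1 f n = bag_candidate a c1 gamma1 f j.+1.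
Proof.
move=> c0 g0 hf Lf kn.
(* No family is empty, so each iteration makes a query and [n] iterations make at least [n] of them:
   the default [set0] of [bag_output] is never read. *)
have size_ge m : (m <= size (bag_run a c1 gamma1 f m))%N.
  rewrite size_bag_run; apply: leq_trans (leq_pmull _ _); last first.
    by rewrite expn_gt0.
  rewrite -[leqLHS]card_ord -sum1_card; apply: leq_sum => i _.
  exact: bag_family_neq0.
have {}kn : (size (bag_run a c1 gamma1 f k) <= n.-1 < n)%N by lia.
have -> : n = (k + (n - k))%N by have := size_ge k; lia.
apply: mem_bag_run; rewrite subnKC; last by have := size_ge k; lia.
case/andP: kn => -> nn /=; exact: leq_trans (size_ge n).
Qed.

Lemma is_approximation_le (R : realType) (d : nat) (f : 'rV[R]_d -> R)
    (a eps eps' : R) S :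
  eps <= eps' -> is_approximation f a eps S -> is_approximation f a eps' S.
Proof.
move=> le_eps [LS SI]; split => // x /SI [Ux fx].
by split => //; apply: le_trans le_eps.
Qed.

(** * Geometric sums and the number of iterations required *)

Lemma sum_expr_le (R : realType) (rho : R) k :
  1 < rho -> \sum_(i < k.+1) rho ^+ i <= rho / (rho - 1) * rho ^+ k.
Proof.
move=> rho1; have p : 0 < rho - 1 by rewrite subr_gt0.
rewrite mulrAC ler_pdivlMr // mulrC -subrX1 exprS.
by rewrite gerBl.
Qed.

Lemma query_bound_ge0 (R : realType)
    (gamma1 dstar kappa1 kappa2 kappa eps : R) :
  0 <= kappa1 -> 0 <= kappa2 -> 0 <= kappa ->
  0 <= query_bound gamma1 dstar kappa1 kappa2 kappa eps.
Proof.
move=> k1 k2 k3; rewrite /query_bound; case: ifP => _.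
  by rewrite addr_ge0 // mulr_ge0 // le_max lexx orbT.
by rewrite mulr_ge0 // divr_ge0 // powR_ge0.
Qed.

(* [k] is the least number of bisections with [B * 2 ^ - (k * (1 + gamma1)) <=
   eps]; its minimality bounds [2 ^ k] by a multiple of
   [eps ^ - (1 / (1 + gamma1))]. *)
Lemma geometric_cost_bound (R : realType) (gamma1 dstar A B : R) :
  0 < gamma1 -> 0 <= dstar -> 0 <= A -> 0 < B ->
  exists kappa1 kappa2 kappa : R,
    [/\ 0 <= kappa1, 0 <= kappa2, 0 <= kappa &
        forall eps : R, 0 < eps -> exists k : nat,
          B * (2^-1 ^+ k) `^ (1 + gamma1) <= eps /\
          A * \sum_(i < k) (2 `^ dstar) ^+ i
            <= query_bound gamma1 dstar kappa1 kappa2 kappa eps].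
Proof.
move=> g0 ds0 A0 B0; have g1 : 0 < 1 + gamma1 by lra.
set rho := 2 `^ dstar; set q : R := 2 `^ (1 + gamma1).
have rho1 : 1 <= rho by rewrite -[leLHS](powRr0 2) ler_powR // ler1n.
have ln2 : 0 < ln 2 :> R by rewrite ln_gt0 // ltr1n.
have q0 : 0 < q by rewrite powR_gt0.
have q1 : 1 < q.
  have := @gt0_ltr_powR R _ g1 1 2.
  by rewrite powR1 !nnegrE ltr1n; apply.
have qE k : (2^-1 ^+ k) `^ (1 + gamma1) = (q ^+ k)^-1.
  rewrite powR_exprn ?invr_ge0 // -powR_inv1 // powRAC powR_inv1 ?powR_ge0 //.
  by rewrite exprVn.
(* The absolute value is there because [log2 B] may be negative; the 1 pays for the last of the
   [k.+1] terms when [dstar = 0]. *)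
pose kappa1 := A * (1 + `|log2 B| / (1 + gamma1)).
(* If [dstar = 0], then [rho - 1 = 0] has inverse 0 by convention, so [kappa] is still nonnegative;
   that case of the bound does not read it. *)
pose kappa := A * (rho / (rho - 1)) * B `^ (dstar / (1 + gamma1)).
have kappa1_ge0 : 0 <= kappa1.
  by rewrite mulr_ge0 // addr_ge0 // divr_ge0 // ltW.
have kappa_ge0 : 0 <= kappa.
  by rewrite !mulr_ge0 ?powR_ge0 ?invr_ge0 ?subr_ge0 // (le_trans ler01).
exists kappa1, A, kappa; split => // eps eps0.
have X0 : 0 < B / eps by rewrite divr_gt0.
have exk : exists k, B / eps <= q ^+ k.
  by have [k /ltW ?] := exists_expr_gt R q (B / eps) q1; exists k.
have [k Bk kmin] := ex_minnP exk; exists k; split.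
  by rewrite qE ler_pdivrMr ?exprn_gt0 // mulrC -ler_pdivrMr.
case: k Bk kmin => [|k] _ kmin.
  by rewrite big_ord0 mulr0 query_bound_ge0.
have qk : q ^+ k < B / eps by rewrite ltNge; apply/negP => /kmin; rewrite ltnn.
rewrite /query_bound; case: eqP => [dstar0|/eqP dstar_neq0].
- have -> : \sum_(i < k.+1) rho ^+ i = 1 + k%:R.
    rewrite /rho dstar0 powRr0; under eq_bigr do rewrite expr1n.
    by rewrite sumr_const card_ord -natr1 addrC.
  rewrite /kappa1 -mulrDr; apply: ler_wpM2l => //.
  rewrite -addrA; apply: lerD => //.
  have lnqk : k%:R * ((1 + gamma1) * ln 2) <= ln B - ln eps.
    rewrite -ln_div ?posrE // -ln_powR -/q mulr_natl -lnXn //.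
    by rewrite ler_ln ?posrE ?exprn_gt0 // ltW.
  have -> : log2 (1 / eps `^ (1 / (1 + gamma1))) =
      - (ln eps / ln 2) / (1 + gamma1).
    rewrite /log2 mul1r lnV ?posrE ?powR_gt0 // ln_powR.
    by field; rewrite !gt_eqF.
  apply: (@le_trans _ _
    (log2 B / (1 + gamma1) - (ln eps / ln 2) / (1 + gamma1))).
    have -> : log2 B / (1 + gamma1) - ln eps / ln 2 / (1 + gamma1) =
        (ln B - ln eps) / ((1 + gamma1) * ln 2).
      by rewrite /log2; field; rewrite !gt_eqF.
    by rewrite ler_pdivlMr // mulr_gt0.
  apply: lerD; first by rewrite ler_wpM2r ?invr_ge0 ?ler_norm // ltW.
  by rewrite mulNr le_max lexx.
have dstar_gt0 : 0 < dstar by rewrite lt_def dstar_neq0.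
have rho_gt1 : 1 < rho.
  have := @gt0_ltr_powR R _ dstar_gt0 1 2.
  by rewrite powR1 !nnegrE ltr1n; apply.
rewrite /kappa -!mulrA; apply: ler_wpM2l => //.
apply: le_trans (sum_expr_le _ _ _ rho_gt1) _; rewrite -mulrA.
do 2![apply: ler_wpM2l;
  first by rewrite ?invr_ge0 ?subr_ge0 // (le_trans ler01)].
(* Rewriting the cube count as a power of [q ^+ k] lets the minimality bound [q ^+ k < B / eps]
   produce the exponent of [eps]. *)
have -> : rho ^+ k = (q ^+ k) `^ (dstar / (1 + gamma1)).
  rewrite powR_exprn ?ltW // /q -powRrM.
  by rewrite mulrC -mulrA mulVf ?mulr1 ?gt_eqF.
have e0 : 0 <= dstar / (1 + gamma1) by rewrite divr_ge0 // ltW.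
rewrite mul1r -(powR_inv1 (powR_ge0 eps _)) powRAC powR_inv1 ?(ltW eps0) //.
rewrite -powRM ?invr_ge0 ?(ltW B0) ?(ltW eps0) //.
by apply: ge0_ler_powR; rewrite // ?nnegrE ?exprn_ge0 ?(ltW q0) ?(ltW X0) ?ltW.
Qed.

(** * The query bound for the algorithm *)

Theorem corollary1 (R : realType) (d : nat) (hd : (1 <= d)%N)
    (a c1 gamma1 : R) (hc1 : 0 < c1) (hgamma1 : 0 < gamma1 <= 1)
    (f : 'rV[R]_d -> R)
    (hf : gradient_holder c1 gamma1 (@unit_cube R d) f)
    (hlevel : level_set f a !=set0)
    (dstar : R) (hdstar : d%:R - 1 <= dstar <= d%:R)
    (hNLS : NLS_dimension f a dstar) :
  exists kappa1 kappa2 kappa : R,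
    [/\ 0 <= kappa1, 0 <= kappa2, 0 <= kappa &
        forall eps : R, 0 < eps ->
        forall n : nat,
          query_bound gamma1 dstar kappa1 kappa2 kappa eps < n%:R ->
          is_approximation f a eps (bag_output a c1 gamma1 f n)].
Proof.
have c0 := ltW hc1; have [g0 _] := andP hgamma1.
have [M fM] := gradient_holder_bounded R d c1 gamma1 f a c0 g0 hf.
have [K K0 sizeK] :=
  size_bag_family_packing R d a c1 gamma1 f dstar c0 g0 hf hNLS.
have [ds0 _] := hNLS.
set B := Num.max (2 * (c1 * d%:R)) M.
have B0 : 0 < B by rewrite lt_max !mulr_gt0 // ltr0n.
have A0 : 0 <= (4 ^ d)%:R * K by rewrite mulr_ge0.
have [kappa1 [kappa2 [kappa [k1 k2 k3 cost]]]] :=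
  geometric_cost_bound R gamma1 dstar _ B g0 ds0 A0 B0.
exists kappa1, kappa2, kappa; split => // eps eps0 n lt_n.
have [k [Bk costk]] := cost _ eps0.
(* The bound exceeds the cost of the first [k] iterations, so the [n]-th query belongs to a later
   one, whose candidate is at least as accurate as required. *)
have run_lt : (size (bag_run a c1 gamma1 f k) < n)%N.
  rewrite -(ltr_nat R); apply: le_lt_trans lt_n; apply: le_trans costk.
  rewrite size_bag_run natrM natr_sum -mulrA ler_wpM2l // mulr_sumr.
  by apply: ler_sum => i _; exact: sizeK.
have [j kj ->] := bag_output_candidate _ _ _ _ _ _ _ _ c0 g0 hf hlevel run_lt.
have := bag_candidate_approximation _ _ _ _ _ _ c0 g0 hf M j fM.
apply: is_approximation_le; apply: le_trans Bk; rewrite -/B.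
rewrite ler_wpM2l ?(ltW B0) //; apply: ge0_ler_powR;
  rewrite ?nnegrE ?exprn_ge0 ?invr_ge0 //; first by lra.
by rewrite ler_wiXn2l ?invr_ge0 // invf_le1 // ler1n.
Qed.
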